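(* Let $G$ be a finite group and suppose there exists an element $x\in G$ such that $nil_G(x)$ generates a maximal subgroup of $G$. (1) If the elements of $nil_G(x)$ commute pairwise, then $G$ is solvable. (2) If $[y_1,y_2,y_3]=1$ for every $y_1,y_2,y_3\in nil_G(x)$, then $G$ is solvable.
   Context: For a group $G$ and $x\in G$, the nilpotentizer of $x$ in $G$ is the subset $nil_G(x)=\{y\in G \mid \langle x,y\rangle \text{ is nilpotent}\}$ (in general not a subgroup). Commutators are defined inductively by $[a_1]=a_1$ and $[a_1,\dots,a_n]=[a_1,\dots,a_{n-1}]^{-1}a_n^{-1}[a_1,\dots,a_{n-1}]a_n$ for $n>1$. All groups are finite. *)

(* Defs.v *)
From mathcomp Require Import all_boot all_fingroup all_solvable.

Set Implicit Arguments.
Unset Strict Implicit.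
Unset Printing Implicit Defensive.

Local Open Scope group_scope.

Definition nilpotentizer (gT : finGroupType) (G : {set gT}) (x : gT) :
    {set gT} :=
  [set y in G | nilpotent <<[set x; y]>>].

(* Main.v *)
(** In both cases [M := <<nilpotentizer G x>>] has class at most 2; dividing out
    its core, assume that [M] contains no nontrivial normal subgroup of [G]. Let
    [P] be a nontrivial Sylow [p]-subgroup of [M]: it is Sylow in [G], and every
    nontrivial normal subgroup of [P] has normaliser [M] in [G]. As the class
    is at most 2, [P] is the only Sylow subgroup of [G] containing ['Z(P)], so
    if [a] and [a ^ g] lie in [P], then applying Sylow's theorem in the
    centraliser of [a] shows that they are already conjugate in [P]. By the
    focal subgroup theorem [G] then has a normal [p]-complement for every prime [p]
    dividing [#|M|], hence a normal [\pi(M)]-complement [K]. Coprime action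
    gives an [M]-invariant nontrivial Sylow subgroup [Q] of [K], and [Q <*> M = G] by
    maximality. *)

Require Import Defs.
From mathcomp Require Import all_boot all_fingroup all_algebra all_solvable.

Local Open Scope group_scope.

Lemma focal_subgroup_sub (gT : finGroupType) (p : nat) (G S R : {group gT}) :
    p.-Sylow(G) S -> R \subset S ->
    (forall a g, a \in S -> g \in G -> a ^ g \in S -> [~ a, g] \in R) ->
  S :&: G^`(1) \subset R.
Proof.
move=> sylS sRS focR; have sSG := pHall_sub sylS.
have sS'R: S^`(1) \subset R.
  rewrite gen_subG; apply/subsetP=> _ /imset2P[a g Sa Sg ->].
  by rewrite focR ?groupJ // (subsetP sSG).
have nsRS: R <| S := sub_der1_normal sS'R sRS.
pose alpha := restrm_morphism (normal_norm nsRS) (coset_morphism R).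
have alphaE: alpha @* S = S / R by rewrite morphim_restrm setIid.
have abA: abelian (alpha @* S) by rewrite alphaE sub_der1_abelian.
pose V := transfer_morphism G abA.
have kerV: G^`(1) \subset 'ker V.
  rewrite gen_subG; apply/subsetP=> _ /imset2P[a g Ga Gg ->].
  apply/kerP; rewrite ?groupR ?morphR //.
  by apply/eqP/commgP; apply: FinRing.zmod_mulgC.
apply/subsetP=> g /setIP[Sg G'g]; have Gg := subsetP sSG g Sg.
have trX := transversalP (rcosets_cycle_partition sSG Gg).
set X := transversal _ _ in trX; pose n x := #|<[g]> : S :* x|.
have Ag: alpha g \in alpha @* S by rewrite mem_morphim.
(* Modulo [R], every factor of the transfer of [g] is a power of [g]. *)
have VgE: V g = (FiniteModule.fmod abA (alpha g) *+ #|G : S|)%R.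
  rewrite /= (transfer_cycle_expansion sSG abA Gg trX).
  rewrite -(sum_index_rcosets_cycle sSG Gg trX) -GRing.sumrMnr.
  apply: eq_bigr => x Xx; rewrite -FiniteModule.fmodX //.
  congr (FiniteModule.fmod abA _); rewrite -morphX //=.
  have Gx: x \in G := subsetP (transversal_sub trX) x Xx.
  have Sgx: (g ^+ n x) ^ x^-1 \in S.
    have := mulg_exp_card_rcosets S g x.
    by rewrite mem_rcoset conjgE invgK mulgA.
  have NRS := subsetP (normal_norm nsRS).
  have Rgx: [~ g ^+ n x, x^-1] \in R by rewrite focR ?groupX ?groupV.
  rewrite conjg_mulR morphM ?groupX //; last exact: (subsetP sRS).
  by rewrite [alpha [~ _, _]](coset_id Rgx) mulg1.
have ag1: alpha g ^+ #|G : S| = 1.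
  rewrite -(FiniteModule.fmodK abA Ag) -FiniteModule.fmvalZ -VgE.
  by rewrite (mker (subsetP kerV g G'g)).
have coSG: coprime #|alpha @* S| #|G : S|.
  have /and3P[_ pS p'GS] := sylS.
  by rewrite (pnat_coprime _ p'GS) //; apply: morphim_pgroup.
apply: coset_idr; first exact: subsetP (normal_norm nsRS) g Sg.
by have := expgK coSG Ag; rewrite ag1 expg1n.
Qed.

(* [p_elt_gen pi^' G] is the residual usually written O^pi(G). *)
Definition p_elt_gen (gT : finGroupType) (pi : nat_pred) (A : {set gT}) :=
  <<[set y in A | pi.-elt y]>>.

Canonical p_elt_gen_group gT pi A := [group of @p_elt_gen gT pi A].

Lemma p_elt_gen_normal gT pi (G : {group gT}) : p_elt_gen gT pi G <| G.
Proof.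
rewrite /normal gen_subG; apply/andP; split.
  by apply/subsetP=> y /setIdP[].
apply: norms_gen; apply/subsetP=> g Gg; rewrite inE.
apply/subsetP=> _ /imsetP[y /setIdP[Gy pi_y] ->].
by rewrite inE p_eltJ pi_y groupJ.
Qed.

Lemma quotient_p_elt_gen gT pi (G : {group gT}) :
  pi.-group (G / p_elt_gen gT pi^' G).
Proof.
apply/pgroupP=> q q_pr /(Cauchy q_pr)[_ /morphimP[y Ny Gy ->] oy].
have Ky: y.`_pi^' \in p_elt_gen gT pi^' G.
  by rewrite mem_gen // inE groupX //= p_elt_constt.
have: pi.-elt (coset (p_elt_gen gT pi^' G) y).
  rewrite -[y](consttC pi) morphM ?groupX // /= (coset_id Ky) mulg1.
  by rewrite morph_p_elt ?groupX ?p_elt_constt.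
by rewrite /p_elt oy pnatE.
Qed.

(* The focal subgroup of [Q := P :&: K] in [K] lies in [[~: Q, P]], which is
   proper in [Q] unless [Q] is trivial. *)
Lemma self_fusion_p_complement (gT : finGroupType) (p : nat)
    (G P : {group gT}) :
    p.-Sylow(G) P ->
    (forall a g, a \in P -> g \in G -> a ^ g \in P ->
       exists2 u, u \in P & a ^ g = a ^ u) ->
  p^'.-group (p_elt_gen gT p^' G).
Proof.
move=> sylP fusP; have pP := pHall_pgroup sylP.
have nsKG := p_elt_gen_normal gT p^' G; set K := p_elt_gen gT p^' G in nsKG *.
have [sKG nKG] := andP nsKG.
pose Q := (P :&: K)%G.
have sylQ: p.-Sylow(K) Q.
  by rewrite /= setIC; apply: Sylow_setI_normal nsKG sylP.
have nQP: P \subset 'N(Q).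
  by rewrite normsI ?normG // (subset_trans (pHall_sub sylP)).
have [Q1|ntQ] := eqsVneq Q 1.
  by rewrite p'groupEpi -p_part_eq1 -(card_Hall sylQ) Q1 cards1.
have sQP : Q \subset P by apply: subsetIl.
have prQ: [~: Q, P] \proper Q.
  by rewrite (nil_comm_properl (pgroup_nil pP)) // subsetI subxx.
have sQK': Q \subset K^`(1).
  have nK'K: K \subset 'N(K^`(1)) := der_norm 1 _.
  have hallA := nilpotent_pcore_Hall p^' (abelian_nil (der_abelian 0 K)).
  have sKA: K \subset coset K^`(1) @*^-1 'O_p^'(K / K^`(1)).
    rewrite gen_subG; apply/subsetP=> y p'y; have Ky: y \in K by apply: mem_gen.
    have [_ pi'y] := setIdP p'y.
    rewrite mem_morphpre ?(subsetP nK'K) // mem_Hall_pcore ?mem_quotient //.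
    by rewrite morph_p_elt // (subsetP nK'K).
  have p'A: p^'.-group (K / K^`(1)).
    apply: pgroupS (pcore_pgroup p^' (K / K^`(1))).
    by rewrite sub_morphim_pre.
  have nK'Q: Q \subset 'N(K^`(1)) := subset_trans (pHall_sub sylQ) nK'K.
  rewrite -quotient_sub1 // -(setIidPl (quotientS _ (pHall_sub sylQ))).
  rewrite coprime_TIg //.
  exact: pnat_coprime (morphim_pgroup _ (pHall_pgroup sylQ)) p'A.
case/negP: (proper_subn prQ).
rewrite -{1}(setIidPl sQK').
apply: (focal_subgroup_sub _ p _ _ [~: Q, P]%G sylQ) => [|a g Qa Kg Qag].
  exact: proper_sub.
have [u Pu] :=
  fusP a g (subsetP sQP a Qa) (subsetP sKG g Kg) (subsetP sQP _ Qag).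
by rewrite !commgEl => ->; rewrite -commgEl mem_commg.
Qed.

Section CoreFree.

Variables (gT : finGroupType) (G M : {group gT}).
Hypotheses (maxM : maximal M G) (sM'Z : M^`(1) \subset 'Z(M)).
Hypothesis coreM : forall H : {group gT}, H \subset M -> H <| G -> H :=: 1.

Let sMG : M \subset G.
Proof. by have /maxgroupP[/proper_sub] := maxM. Qed.

Let nilM : nilpotent M.
Proof. by rewrite -quotient_center_nil abelian_nil // sub_der1_abelian. Qed.

Lemma maximal_sub_eq (H : {group gT}) :
  M \subset H -> H \subset G -> ~~ (H \subset M) -> H :=: G.
Proof.
move=> sMH sHG nsHM; have /maxgroupP[_ maxM'] := maxM.
apply/eqP; rewrite eqEproper sHG; apply: contra nsHM => prHG.
by rewrite (maxM' H).
Qed.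

Lemma corefree_norm (H : {group gT}) :
  H :!=: 1 -> H \subset M -> M \subset 'N(H) -> 'N_G(H) = M.
Proof.
move=> ntH sHM nHM; apply/eqP; rewrite eqEsubset subsetI sMG nHM !andbT.
apply: contraNT ntH => nsNM; apply/eqP/coreM => //.
have sNG: 'N_G(H) = G.
  by apply: maximal_sub_eq; rewrite ?subsetIl // subsetI sMG.
by rewrite /normal (subset_trans sHM sMG) -{1}sNG subsetIr.
Qed.

Section Sylow.

Variables (p : nat) (P : {group gT}).
Hypotheses (sylP : p.-Sylow(M) P) (ntP : P :!=: 1).

Let sPM : P \subset M := pHall_sub sylP.
Let pP : p.-group P := pHall_pgroup sylP.

Let nsPM : P <| M.
Proof. by rewrite (nilpotent_Hall_pcore nilM sylP) pcore_normal. Qed.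

Let defM : P \x 'O_p^'(M) = M.
Proof. by rewrite {1}(nilpotent_Hall_pcore nilM sylP) nilpotent_pcoreC. Qed.

Let sub_normP (H : {group gT}) :
  H \subset P -> P \subset 'N(H) -> M \subset 'N(H).
Proof.
move=> sHP nHP; have [_ defM' cPO _] := dprodP defM.
rewrite -{1}defM'.
by rewrite mul_subG // cents_norm // (subset_trans cPO) ?centS.
Qed.

Let p_subP (H : {group gT}) : H \subset M -> p.-group H -> H \subset P.
Proof. by move=> sHM; rewrite (sub_normal_Hall sylP). Qed.

Lemma Sylow_corefree_maximal : p.-Sylow(G) P.
Proof.
have NP: 'N_G(P) = M by apply: corefree_norm => //; apply: normal_norm.
by rewrite -Sylow_subnorm NP.
Qed.

Let sP'Z : P^`(1) \subset 'Z(P).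
Proof.
rewrite subsetI der_sub (subset_trans (dergS 1 sPM)) // (subset_trans sM'Z) //.
by rewrite (subset_trans (subsetIr _ _)) ?centS.
Qed.

Let ntZ : 'Z(P) != 1.
Proof. by apply: contra ntP; move/eqP/(trivg_center_pgroup pP)->. Qed.

(* [P :&: Q] contains [P^`(1)] and [Q^`(1)], so [P] and [Q] normalise it. *)
Lemma center_sub_Sylow_eq (Q : {group gT}) :
  p.-Sylow(G) Q -> 'Z(P) \subset Q -> Q :=: P.
Proof.
move=> sylQ sZQ; have sQG := pHall_sub sylQ; have pQ := pHall_pgroup sylQ.
have sQ'Z: Q^`(1) \subset 'Z(Q).
  have [x _ ->] := Sylow_trans Sylow_corefree_maximal sylQ.
  by rewrite derJ /center centJ -conjIg conjSg.
have NZ: 'N_G('Z(P)) = M.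
  apply: corefree_norm; rewrite ?(subset_trans (center_sub P)) //.
  by apply: sub_normP; rewrite ?center_sub // normal_norm ?center_normal.
have sZQP: 'Z(Q) \subset P.
  apply: p_subP; last exact: pgroupS (center_sub Q) pQ.
  rewrite /= -NZ subsetI (subset_trans (center_sub Q)) // cents_norm // centsC.
  by rewrite (subset_trans sZQ) // centsC subsetIr.
pose D := (P :&: Q)%G.
have sZD: 'Z(P) \subset D by rewrite subsetI center_sub.
have nDP: P \subset 'N(D).
  by rewrite normal_norm // sub_der1_normal ?subsetIl // (subset_trans sP'Z).
have nDQ: Q \subset 'N(D).
  rewrite normal_norm // sub_der1_normal ?subsetIr // (subset_trans sQ'Z) //.
  by rewrite subsetI sZQP center_sub.
have ND: 'N_G(D) = M.
  apply: corefree_norm; first by apply: subG1_contra sZD ntZ.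
    by rewrite (subset_trans (subsetIl _ _)).
  by apply: sub_normP; rewrite ?subsetIl.
apply/eqP; rewrite eqEcard (card_Hall sylQ) (card_Hall Sylow_corefree_maximal).
rewrite leqnn andbT.
by apply: p_subP => //; rewrite -ND subsetI sQG.
Qed.

Lemma Sylow_self_fusion a g :
  a \in P -> g \in G -> a ^ g \in P -> exists2 u, u \in P & a ^ g = a ^ u.
Proof.
move=> Pa Gg Pag; have sPG := pHall_sub Sylow_corefree_maximal.
have sZP := center_sub P.
have pZ := pgroupS sZP pP.
have Ca b : b \in P -> 'Z(P) \subset 'C_G[b].
  move=> Pb; rewrite subsetI (subset_trans sZP) //= sub_cent1.
  by apply: subsetP Pb; rewrite centsC subsetIr.
have [R sylR sZR] := Sylow_superset (Ca a Pa) pZ.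
have sZgC: 'Z(P) :^ g^-1 \subset 'C_G[a].
  by rewrite sub_conjgV conjIg (conjGid Gg) -cent1J Ca.
have pZg: p.-group ('Z(P) :^ g^-1) by rewrite pgroupJ.
have [c /setIP[Gc ca] sZgcR] := Sylow_Jsub sylR sZgC pZg.
have sRG: R \subset G := subset_trans (pHall_sub sylR) (subsetIl _ _).
have [Q sylQ sRQ] := Sylow_superset sRG (pHall_pgroup sylR).
have defQ := center_sub_Sylow_eq Q sylQ (subset_trans sZR sRQ).
pose n := c^-1 * g; have Gn: n \in G by rewrite groupM ?groupV.
have defQn: P :^ n = P.
  rewrite -{1}defQ; apply: center_sub_Sylow_eq; first by rewrite pHallJ.
  rewrite -sub_conjgV invMg invgK conjsgM.
  exact: subset_trans sZgcR sRQ.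
have Mn: n \in M.
  rewrite -(corefree_norm P ntP sPM (normal_norm nsPM)) inE Gn.
  by apply/normP.
have [_ defM' cPO _] := dprodP defM.
have: n \in P * 'O_p^'(M) by rewrite defM'.
case/mulsgP=> u h Pu Oh def_n; exists u => //.
have ->: g = c * n by rewrite mulKVg.
rewrite conjgM [a ^ c]conjgE -(cent1P ca) mulKg def_n conjgM.
by rewrite [_ ^ h]conjgE -(centsP cPO h Oh) ?groupJ // mulKg.
Qed.

End Sylow.

Lemma corefree_maximal_solvable : solvable G.
Proof.
pose pi : nat_pred := \pi(M); pose K := p_elt_gen_group gT pi^' G.
have nsKG: K <| G := p_elt_gen_normal gT pi^' G.
have sylM p (P : {group gT}) : p \in pi -> p.-Sylow(M) P -> P :!=: 1.
  by move=> pi_p sylP; rewrite trivg_card1 (card_Hall sylP) p_part_eq1 negbK.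
have pi'K: pi^'.-group K.
  apply/pgroupP=> r r_pr rK; apply/negP=> pi_r.
  have [P sylP] := Sylow_exists r M; have ntP := sylM r P pi_r sylP.
  have r'Kr := self_fusion_p_complement _ r G P
    (Sylow_corefree_maximal r P sylP ntP) (Sylow_self_fusion r P sylP ntP).
  have sKKr: K \subset p_elt_gen gT r^' G.
    apply/genS/subsetP=> y; rewrite !inE => /andP[-> pi'y] /=.
    by apply: sub_p_elt pi'y => q; apply: contra => /eqP->.
  by have /pgroupP/(_ r r_pr rK) := pgroupS sKKr r'Kr; rewrite !inE eqxx.
have pi'iMG: pi^'.-nat #|G : M|.
  apply/pnatP=> // r r_pr r_iM; apply/negP=> pi_r.
  have [P sylP] := Sylow_exists r M; have ntP := sylM r P pi_r sylP.
  have /and3P[_ _ r'iP] := Sylow_corefree_maximal r P sylP ntP.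
  have: r^'.-nat #|G : M|.
    apply: pnat_dvd r'iP; rewrite -(Lagrange_index sMG (pHall_sub sylP)).
    exact: dvdn_mulr.
  by move/(pnat_dvd r_iM); rewrite pnatE // !inE eqxx.
have ntK: K :!=: 1.
  apply/eqP=> K1; have: pi.-group (G / K) := quotient_p_elt_gen gT pi G.
  rewrite /pgroup card_quotient ?normal_norm // K1 indexg1.
  rewrite -(Lagrange sMG) pnatM => /andP[_ pi_iM].
  have /eqP := pnat_1 pi_iM pi'iMG; rewrite indexg_eq1 => sGM.
  by have /maxgroupP[/proper_subn/negP[]] := maxM.
have coKM: coprime #|K| #|M|.
  by rewrite coprime_sym (pnat_coprime _ pi'K) //; apply: pgroup_pi.
have nKM: M \subset 'N(K) := subset_trans sMG (normal_norm nsKG).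
have [Q sylQ nQM] :=
  sol_coprime_Sylow_exists (pdiv #|K|) (nilpotent_sol nilM) nKM coKM.
have ntQ: Q :!=: 1.
  by rewrite trivg_card1 (card_Hall sylQ) p_part_eq1 negbK pi_pdiv cardG_gt1.
have defG: Q <*> M = G.
  apply: maximal_sub_eq; rewrite ?joing_subr //.
    by rewrite join_subG sMG (subset_trans (pHall_sub sylQ)) // normal_sub.
  rewrite join_subG subxx andbT; apply: contra ntQ => sQM.
  rewrite -subG1 -(coprime_TIg coKM) subsetI sQM andbT.
  exact: pHall_sub sylQ.
rewrite -defG (series_sol (H := Q)).
  rewrite (pgroup_sol (pHall_pgroup sylQ)) quotientYidl //.
  by rewrite quotient_sol // nilpotent_sol.
by rewrite /normal joing_subl join_subG normG.
Qed.

End CoreFree.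

Lemma class2_maximal_solvable (gT : finGroupType) (G M : {group gT}) :
  maximal M G -> M^`(1) \subset 'Z(M) -> solvable G.
Proof.
move=> maxM sM'Z; have /maxgroupP[/proper_sub sMG _] := maxM.
pose N := [group of gcore M G].
have nsNG: N <| G := gcore_normal sMG.
have sNM: N \subset M := gcore_sub M G.
have nsNM: N <| M := normalS sNM sMG nsNG.
rewrite (series_sol nsNG); apply/andP; split.
  rewrite (solvableS sNM) // nilpotent_sol // -quotient_center_nil.
  by rewrite abelian_nil // sub_der1_abelian.
apply: (corefree_maximal_solvable _ _ (M / N)%G).
- by rewrite quotient_maximal.
- rewrite -quotient_der ?normal_norm //.
  apply: subset_trans (quotientS _ sM'Z) _.
  by rewrite subsetI quotientS ?center_sub // quotient_cents // subsetIr.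
move=> H sHM nsHG.
have [L defH sNL nsLG] := inv_quotientN nsNG nsHG.
have sLN: L \subset N.
  rewrite gcore_max ?normal_norm //.
  rewrite -(quotientSGK _ sNM) -?defH //.
  by rewrite (subset_trans (normal_sub nsLG)) ?normal_norm.
by rewrite defH; apply/trivgP; rewrite quotient_sub1 ?(subset_trans sLN) ?normG.
Qed.

Theorem theorem1p2 (gT : finGroupType) (G : {group gT}) (x : gT)
    (xG : x \in G) (maxN : maximal <<nilpotentizer G x>> G) :
  ((forall y z : gT, y \in nilpotentizer G x -> z \in nilpotentizer G x ->
      y * z = z * y) ->
    solvable G) /\
  ((forall y1 y2 y3 : gT, y1 \in nilpotentizer G x ->
      y2 \in nilpotentizer G x -> y3 \in nilpotentizer G x ->
      [~ y1, y2, y3] = 1) ->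
    solvable G).
Proof.
set S := nilpotentizer G x in maxN *.
suffices solG: (forall y1 y2 y3, y1 \in S -> y2 \in S -> y3 \in S ->
    [~ y1, y2, y3] = 1) -> solvable G.
  split=> // cSS; apply: solG => y1 y2 y3 Sy1 Sy2 _.
  by have /commgP/eqP-> : commute y1 y2 := cSS y1 y2 Sy1 Sy2; rewrite comm1g.
move=> comm3; apply: class2_maximal_solvable maxN _.
have sSN: S \subset 'N('Z(<<S>>)).
  exact: subset_trans (subset_gen S) (normal_norm (center_normal _)).
have sSSZ: [~: S, S] \subset 'Z(<<S>>).
  rewrite gen_subG; apply/subsetP=> _ /imset2P[y1 y2 Sy1 Sy2 ->].
  rewrite inE groupR ?mem_gen //= cent_gen; apply/centP=> y3 Sy3.
  by apply/commgP/eqP/comm3.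
rewrite -quotient_cents2 ?gen_subG // quotient_gen //.
by rewrite cent_gen gen_subG quotient_cents2.
Qed.
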